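(* Let $H$ be a Hilbert space and let $\mathcal T=(T(t))_{t\ge0}$ be a $C_0$-semigroup on $H$. Then $\mathcal T$ is similar to a semigroup of contractions (i.e. there is an invertible $R\in\mathcal L(H)$ with $\|RT(t)R^{-1}\|\le1$ for all $t\ge0$) if and only if the following two conditions hold: (i) $\mathcal T$ is similar to a quasi-contraction semigroup, i.e. there exist an invertible $R\in\mathcal L(H)$ and $\lambda\in\mathbb R$ with $\|RT(t)R^{-1}\|\le e^{\lambda t}$ for all $t\ge0$; (ii) there exists $\tau>0$ such that $T(\tau)$ is similar to a contraction on $H$, i.e. $\|R'T(\tau)R'^{-1}\|\le 1$ for some invertible $R'\in\mathcal L(H)$. *)

(* Defs.v *)
(* MathComp + MathComp-Analysis (realType, expR) + real_closed complex (R[i]). *)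
From HB Require Import structures.
From mathcomp Require Import all_boot all_order all_algebra.
From mathcomp Require Import reals sequences exp.
From mathcomp Require Import complex.
Set Implicit Arguments. Unset Strict Implicit. Unset Printing Implicit Defensive.
Import Order.TTheory GRing.Theory Num.Theory.
Local Open Scope ring_scope.

(* A complex Hilbert space: a complex vector space H (lmodType over R[i], R a
   real field of real numbers) with an inner product ip, linear in the first
   argument, conjugate symmetric, positive definite, and complete for the
   induced norm. *)

Section Hilbert.
Variable R : realType.
Variable H : lmodType R[i].
Variable ip : H -> H -> R[i].

Definition inner_product : Prop :=
  [/\ (forall (a : R[i]) (x y z : H), ip (a *: x + y) z = a * ip x z + ip y z),
      (forall x y : H, ip x y = (ip y x)^*),
      (forall x : H, 0 <= ip x x) &
      (forall x : H, ip x x = 0 -> x = 0)].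

(* induced norm ||x|| = sqrt <x,x> *)
Definition hnorm (x : H) : R := Num.sqrt (complex.Re (ip x x)).

Definition hcauchy (u : nat -> H) : Prop :=
  forall e : R, 0 < e -> exists N : nat, forall m n : nat,
    (N <= m)%N -> (N <= n)%N -> hnorm (u m - u n) < e.

Definition hconverges (u : nat -> H) : Prop :=
  exists l : H, forall e : R, 0 < e -> exists N : nat, forall n : nat,
    (N <= n)%N -> hnorm (u n - l) < e.

Definition hilbert_space : Prop :=
  inner_product /\ forall u : nat -> H, hcauchy u -> hconverges u.

(* bounded linear operators, L(H) *)
Definition lin_op (A : H -> H) : Prop :=
  forall (a : R[i]) (x y : H), A (a *: x + y) = a *: A x + A y.

Definition bounded_op (A : H -> H) : Prop :=
  lin_op A /\ exists M : R, forall x : H, hnorm (A x) <= M * hnorm x.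

(* ||A|| <= c, unfolded *)
Definition opnorm_le (A : H -> H) (c : R) : Prop :=
  forall x : H, hnorm (A x) <= c * hnorm x.

(* S is invertible in L(H) with inverse Si *)
Definition invertible_with (S Si : H -> H) : Prop :=
  [/\ bounded_op S, bounded_op Si, cancel S Si & cancel Si S].

(* A C_0-semigroup (T(t))_{t >= 0}; values of T at t < 0 are irrelevant. *)
Definition C0_semigroup (T : R -> H -> H) : Prop :=
  [/\ (forall t : R, 0 <= t -> bounded_op (T t)),
      (forall x : H, T 0 x = x),
      (forall s t : R, 0 <= s -> 0 <= t -> forall x : H, T (s + t) x = T s (T t x)) &
      (* strong continuity of t |-> T(t)x on [0, +oo) *)
      (forall (x : H) (t0 : R), 0 <= t0 -> forall e : R, 0 < e ->
         exists2 d : R, 0 < d & forall t : R, 0 <= t -> `|t - t0| < d ->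
           hnorm (T t x - T t0 x) < e)].

(* T is similar to a contraction semigroup *)
Definition similar_to_contraction_sg (T : R -> H -> H) : Prop :=
  exists S Si : H -> H, invertible_with S Si /\
    forall t : R, 0 <= t -> opnorm_le (fun x => S (T t (Si x))) 1.

(* T is similar to a quasi-contraction semigroup *)
Definition similar_to_quasi_contraction_sg (T : R -> H -> H) : Prop :=
  exists (S Si : H -> H) (lam : R), invertible_with S Si /\
    forall t : R, 0 <= t -> opnorm_le (fun x => S (T t (Si x))) (expR (lam * t)).

(* a single operator A is similar to a contraction *)
Definition similar_to_contraction (A : H -> H) : Prop :=
  exists S Si : H -> H, invertible_with S Si /\ opnorm_le (fun x => S (A (Si x))) 1.

End Hilbert.

(* Main.v *)
(** A quasi-contractive Hilbert norm alone does not see the period [tau], and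
   averaging a [T tau]-contractive one over [0, tau] degenerates on vectors that
   the semigroup kills quickly.  Let [q1], [q2] be the squares of equivalent
   Hilbert norms with [q1 (T tau x) <= q1 x] and
   [q2 (T t x) <= exp (2 lam t) * q2 x], and for [0 <= t <= tau] put
     [w t y = q1 (T (tau - t) y)
              + inf_x (q1 x - q1 (T tau x) + exp (- 2 lam t) * q2 (y - T t x))].
   Then [w (t + s) (T s y) <= w t y], [w 0 <= q1 <= w tau], and each [w t] is
   the square of a Hilbert norm, equivalent to the given one uniformly in [t]:
   if [w t y] is small then [y] is close to [T t x], where both [q1 (T tau x)]
   and [q1 x - q1 (T tau x)] are small, hence [x] and [y] are small.  Averaging
   [w] over the points [k tau / n], [k < n], gives a Hilbert norm contracted by
   [T (tau / n)], and an ultrafilter limit in [n] gives one contracted by the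
   whole semigroup.  Hilbert norms are handled through the parallelogram law,
   which is stable under infima and limits; Jordan-von Neumann, Riesz and an
   operator square root finally turn the new norm into a similarity. *)
Require Import Defs.
From HB Require Import structures.
From mathcomp Require Import all_boot all_order all_algebra.
From mathcomp Require Import boolp classical_sets filter topology normedtype.
From mathcomp Require Import reals sequences exp.
From mathcomp Require Import complex.
From mathcomp Require Import ring lra.
Set Implicit Arguments.
Unset Strict Implicit.
Unset Printing Implicit Defensive.
Import Order.TTheory GRing.Theory Num.Theory.
Import numFieldNormedType.Exports.
Local Open Scope classical_set_scope.
Local Open Scope ring_scope.

(** * Functionals satisfying the parallelogram law *)

(** The defect [h t = g t - t * g 1] vanishes at the naturals, so its bound on [0, 1] spreads to all
    [t >= 0]. By additivity a nonzero value would be unbounded along its multiples. *)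
Lemma additive_bounded_linear (R : realType) (g : R -> R) (K : R) :
  (forall s t, g (s + t) = g s + g t) ->
  (forall t, 0 <= t <= 1 -> `|g t| <= K) -> forall t, g t = t * g 1.
Proof.
move=> gD gK.
have g0 : g 0 = 0 by have := gD 0 0; rewrite addr0; lra.
have gN t : g (- t) = - g t by have := gD t (- t); rewrite subrr g0; lra.
have gn n t : g (n%:R * t) = n%:R * g t.
  elim: n => [|n IH]; first by rewrite !mul0r g0.
  by rewrite -!natr1 !mulrDl !mul1r gD IH.
pose h t := g t - t * g 1.
have hK t : 0 <= t -> `|h t| <= K + `|g 1|.
  move=> t0; pose n := Num.truncn t.
  have /andP[nt tn] : n%:R <= t < n.+1%:R by exact: truncn_itv.
  have r01 : 0 <= t - n%:R <= 1 by rewrite -natr1 in tn; lra.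
  have -> : h t = g (t - n%:R) - (t - n%:R) * g 1.
    have := gn n 1; rewrite mulr1 /h gD gN => ->; ring.
  rewrite (le_trans (ler_normB _ _)) // lerD ?gK // normrM.
  by rewrite ler_piMl // ger0_norm; case/andP: r01.
have h0 t : 0 <= t -> h t = 0.
  move=> t0; apply/eqP/negPn/negP => ht.
  have ht0 : 0 < `|h t| by rewrite normr_gt0.
  pose n := (Num.truncn ((K + `|g 1|) / `|h t|)).+1.
  have : `|h (n%:R * t)| <= K + `|g 1| by rewrite hK // mulr_ge0.
  have -> : h (n%:R * t) = n%:R * h t by rewrite /h gn; ring.
  rewrite normrM ger0_norm ?ler0n // -ler_pdivlMr // leNgt.
  by rewrite truncnS_gt.
move=> t; have [t0|t0] := leP 0 t; first by have := h0 t t0; rewrite /h; lra.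
by have := h0 (- t); rewrite /h gN mulNr => H; have := H ltac:(lra); lra.
Qed.

Section QuadraticFunctionals.
Variables (R : realType) (V : lmodType R[i]).
Implicit Types (p : V -> R) (x y z : V) (a : R[i]) (t : R).

(** Squared modulus with values in [R]; the norm of [R[i]] takes its values in [R[i]]. *)
Definition sqmod a : R := complex.Re a ^+ 2 + complex.Im a ^+ 2.

(** Squares of Hilbert seminorms. They may be degenerate, as [q1 x - q1 (T tau x)] below can be. *)
Definition quad p : Prop :=
  [/\ forall x, 0 <= p x,
      forall x y, p (x + y) + p (x - y) = 2 * p x + 2 * p y &
      forall a x, p (a *: x) = sqmod a * p x].

(** Real part of the associated sesquilinear form; the imaginary part is its value at [x] and
    ['i%C *: y]. *)
Definition polar p x y : R := (p (x + y) - p (x - y)) / 4.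

Lemma sqmod_ge0 a : 0 <= sqmod a.
Proof. by rewrite addr_ge0 // sqr_ge0. Qed.

Lemma sqmodV a : a != 0 -> sqmod a^-1 * sqmod a = 1.
Proof.
case: a => a b; rewrite eq_complex /= negb_and /sqmod /= => ab.
have d0 : a ^+ 2 + b ^+ 2 != 0 by rewrite paddr_eq0 ?sqr_ge0 // !sqrf_eq0 negb_and.
by field.
Qed.

Lemma sqmod_real t : sqmod t%:C%C = t ^+ 2.
Proof. by rewrite /sqmod /= expr0n /= addr0. Qed.

Section Polarization.
Variables (p : V -> R) (hp : quad p).

Let p_ge0 : forall x, 0 <= p x. Proof. by case: hp. Qed.
Let p_par : forall x y, p (x + y) + p (x - y) = 2 * p x + 2 * p y.
Proof. by case: hp. Qed.
Let p_scale : forall a x, p (a *: x) = sqmod a * p x. Proof. by case: hp. Qed.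

Lemma quad0 : p 0 = 0.
Proof. by rewrite -(scale0r 0) p_scale /sqmod /= expr0n addr0 mul0r. Qed.

Lemma quadN x : p (- x) = p x.
Proof. by rewrite -scaleN1r p_scale /sqmod /= oppr0 expr0n sqrrN expr1n addr0 mul1r. Qed.

Lemma quadBC x y : p (x - y) = p (y - x).
Proof. by rewrite -quadN opprB. Qed.

Lemma quad_real t x : p (t%:C%C *: x) = t ^+ 2 * p x.
Proof. by rewrite p_scale sqmod_real. Qed.

Lemma quadi x : p ('i%C *: x) = p x.
Proof. by rewrite p_scale /sqmod /= expr0n expr1n add0r mul1r. Qed.

Lemma polarC x y : polar p x y = polar p y x.
Proof. by rewrite /polar (addrC x) (quadBC x). Qed.

Lemma polar0l y : polar p 0 y = 0.
Proof. by rewrite /polar add0r sub0r quadN subrr mul0r. Qed.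

(** Difference of the parallelogram laws for the pairs [x + y], [z] and [x - y], [z]. *)
Lemma polar_par x z y : polar p (x + z) y + polar p (x - z) y = 2 * polar p x y.
Proof.
have e1 : x + y + z = x + z + y by rewrite addrAC.
have e2 : x + y - z = x - z + y by rewrite addrAC.
have e3 : x - y + z = x + z - y by rewrite addrAC.
have e4 : x - y - z = x - z - y by rewrite addrAC.
have := p_par (x + y) z; have := p_par (x - y) z; rewrite e1 e2 e3 e4 /polar.
by lra.
Qed.

(** [polar_par] with [z := x] gives doubling; applied to [x + z] and [x - z] it then gives
    additivity. *)
Lemma polarDl x z y : polar p (x + z) y = polar p x y + polar p z y.
Proof.
have d u : polar p (u + u) y = 2 * polar p u y.
  by have := polar_par u u y; rewrite subrr polar0l addr0.
have := polar_par (x + z) (x - z) y.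
have -> : x + z + (x - z) = x + x by rewrite addrACA subrr addr0.
have -> : x + z - (x - z) = z + z by rewrite opprB addrC addrA subrK.
by rewrite !d; lra.
Qed.

Lemma polarDr x y z : polar p x (y + z) = polar p x y + polar p x z.
Proof. by rewrite polarC polarDl !(polarC _ x). Qed.

Lemma quadD_le x y : p (x + y) <= 2 * p x + 2 * p y.
Proof. by rewrite -p_par lerDl. Qed.

Lemma polar_bound x y : `|polar p x y| <= (p x + p y) / 2.
Proof.
have := quadD_le x y; have := quadD_le x (- y); rewrite quadN /polar.
have := p_ge0 (x + y); have := p_ge0 (x - y) => *.
by rewrite ler_norml; apply/andP; split; lra.
Qed.

(** Additivity and the bound [polar_bound] for scalars in [0, 1] replace the usual continuity
    argument. *)
Lemma polarZl t x y : polar p (t%:C%C *: x) y = t * polar p x y.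
Proof.
have -> : polar p x y = polar p ((1 : R)%:C%C *: x) y by rewrite scale1r.
apply: (@additive_bounded_linear R (fun s => polar p (s%:C%C *: x) y) ((p x + p y) / 2)).
  by move=> u v; rewrite rmorphD scalerDl polarDl.
move=> u /andP[u0 u1]; rewrite (le_trans (polar_bound _ _)) // quad_real.
have : u ^+ 2 * p x <= p x by rewrite ler_piMl // expr_le1.
by lra.
Qed.

Lemma polarZr t x y : polar p x (t%:C%C *: y) = t * polar p x y.
Proof. by rewrite polarC polarZl polarC. Qed.

Lemma polarNr x y : polar p x (- y) = - polar p x y.
Proof. by rewrite /polar opprK -mulNr opprB. Qed.

Lemma polarxx x : polar p x x = p x.
Proof.
have := p_par x x; rewrite /polar subrr quad0; lra.
Qed.

Lemma polarii x y : polar p ('i%C *: x) ('i%C *: y) = polar p x y.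
Proof. by rewrite /polar -scalerDr -scalerBr !quadi. Qed.

Lemma polaril x y : polar p ('i%C *: x) y = - polar p x ('i%C *: y).
Proof.
have := polarii x ('i%C *: y).
by rewrite scalerA -expr2 sqr_i scaleN1r polarNr => <-; rewrite opprK.
Qed.

Lemma quadD x y : p (x + y) = p x + 2 * polar p x y + p y.
Proof. by rewrite -polarxx !(polarDl, polarDr) !polarxx (polarC y x); lra. Qed.

Lemma quadB x y : p (x - y) = p x - 2 * polar p x y + p y.
Proof. by rewrite quadD polarNr quadN; lra. Qed.

Lemma polar_CS x y : polar p x y ^+ 2 <= p x * p y.
Proof.
have h (t : R) : 0 <= p x + 2 * t * polar p x y + t ^+ 2 * p y.
  by have := p_ge0 (x + t%:C%C *: y); rewrite quadD polarZr quad_real; lra.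
have := p_ge0 y; rewrite le_eqVlt => /orP[/eqP py0|py].
  rewrite -py0 mulr0; set b := polar p x y in h *.
  have := h (- (p x + 1) * b); rewrite -py0 mulr0 addr0 => hb.
  have := p_ge0 x => px; have b2 := sqr_ge0 b.
  have -> // : b ^+ 2 <= 0.
  have [//|b0] := leP (b ^+ 2) 0.
  (* If [p y = 0], the polynomial in [h] is affine in [t]; at this [t] it would equal -1. *)
  have := h (- (p x + 1) / (2 * b ^+ 2) * b); rewrite -py0 mulr0 addr0.
  have -> : 2 * (- (p x + 1) / (2 * b ^+ 2) * b) * b = - (p x + 1).
    by field; rewrite -sqrf_eq0 gt_eqF.
  by lra.
have := h (- polar p x y / p y).
have -> : p x + 2 * (- polar p x y / p y) * polar p x y + (- polar p x y / p y) ^+ 2 * p y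
  = (p x * p y - polar p x y ^+ 2) / p y by field; rewrite gt_eqF.
by rewrite ler_pdivlMr // mul0r subr_ge0.
Qed.

(** Expansion of [p (e x - y) >= 0]. The factor of [p x] tends to 1 with [e], so a limit of such
    bounds can still express contractivity. *)
Lemma quadD_eps e x y : 0 < e -> p (x + y) <= (1 + e) * p x + (1 + e^-1) * p y.
Proof.
move=> e0; rewrite quadD.
have := p_ge0 (e%:C%C *: x - y); rewrite quadB polarZl quad_real => h.
have : 0 <= e^-1 * (e ^+ 2 * p x - 2 * (e * polar p x y) + p y).
  by rewrite mulr_ge0 // invr_ge0 ltW.
have -> : e^-1 * (e ^+ 2 * p x - 2 * (e * polar p x y) + p y) =
   e * p x - 2 * polar p x y + e^-1 * p y by field; rewrite gt_eqF.
by lra.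
Qed.

End Polarization.
End QuadraticFunctionals.

(** * Operations preserving the parallelogram law *)

Section QuadClosure.
Variables (R : realType) (V W : lmodType R[i]).

Lemma quad_comp (p : V -> R) (A : W -> V) : quad p ->
  (forall a x y, A (a *: x + y) = a *: A x + A y) -> quad (fun x => p (A x)).
Proof.
move=> [p0 pP pZ] hA.
have A0 : A 0 = 0 by have := hA (-1) 0 0; rewrite scaler0 addr0 scaleN1r addNr.
have AD x y : A (x + y) = A x + A y by have := hA 1 x y; rewrite !scale1r.
have AZ a x : A (a *: x) = a *: A x by have := hA a x 0; rewrite A0 !addr0.
have AN x : A (- x) = - A x by rewrite -scaleN1r AZ scaleN1r.
by split=> // *; rewrite ?AD ?AN ?AZ.
Qed.

Lemma quad_add (p q : V -> R) : quad p -> quad q -> quad (fun x => p x + q x).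
Proof.
move=> [p0 pP pZ] [q0 qP qZ]; split=> [x|x y|a x]; first by rewrite addr_ge0.
- by have := pP x y; have := qP x y; lra.
- by rewrite pZ qZ mulrDr.
Qed.

Lemma quad_scale c (p : V -> R) : 0 <= c -> quad p -> quad (fun x => c * p x).
Proof.
move=> c0 [p0 pP pZ]; split=> [x|x y|a x]; first by rewrite mulr_ge0.
- by rewrite -mulrDr pP; ring.
- by rewrite pZ mulrCA.
Qed.

Lemma quad_sub (p q : V -> R) : quad p -> quad q -> (forall x, q x <= p x) ->
  quad (fun x => p x - q x).
Proof.
move=> [p0 pP pZ] [q0 qP qZ] qp; split=> [x|x y|a x]; first by rewrite subr_ge0.
- by have := pP x y; have := qP x y; lra.
- by rewrite pZ qZ mulrBr.
Qed.

Lemma quad_sum n (p : nat -> V -> R) : (forall k, (k < n)%N -> quad (p k)) ->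
  quad (fun x => \sum_(k < n) p k x).
Proof.
move=> hp; split=> [x|x y|a x].
- by apply: sumr_ge0 => k _; case: (hp k (ltn_ord k)).
- rewrite -big_split !mulr_sumr -big_split; apply: eq_bigr => k _ /=.
  by case: (hp k (ltn_ord k)).
- by rewrite mulr_sumr; apply: eq_bigr => k _; case: (hp k (ltn_ord k)).
Qed.

(* The parallelogram inequality in one direction is immediate for an infimum;
   the other one is the same inequality at [y + z] and [y - z]. *)
Lemma quad_inf (g : W * V -> R) : quad g ->
  quad (fun y => inf [set g (x, y) | x in setT]%classic).
Proof.
move=> hg; have [g0 gP gZ] := hg.
have g_par x y x' z : g (x + x', y + z) + g (x - x', y - z) =
  2 * g (x, y) + 2 * g (x', z) := gP (x, y) (x', z).
have g_scale a x y : g (a *: x, a *: y) = sqmod a * g (x, y) := gZ a (x, y).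
set p := fun y => _.
have p_le x y : p y <= g (x, y).
  by apply: ge_inf; [exists 0 => _ [z _ <-] | exists x].
have p_ge c y : (forall x, c <= g (x, y)) -> c <= p y.
  move=> h; apply: lb_le_inf => [|_ [z _ <-] //].
  by exists (g (0, y)), 0.
have p0 y : 0 <= p y by exact: p_ge.
have half y z : p (y + z) + p (y - z) <= 2 * p y + 2 * p z.
  (* The infima [p y] and [p z] are replaced one after the other by values of [g]; [g_par] applies
     once [x] and [x'] are both fixed. *)
  have hy : (p (y + z) + p (y - z) - 2 * p z) / 2 <= p y; last by lra.
  apply: (p_ge _ _) => x.
  have hz : (p (y + z) + p (y - z) - 2 * g (x, y)) / 2 <= p z; last by lra.
  apply: (p_ge _ _) => x'.
  have := g_par x y x' z; have := p_le (x + x') (y + z).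
  by have := p_le (x - x') (y - z); lra.
have pZ_le a y : p (a *: y) <= sqmod a * p y.
  have [a0|a0] := eqVneq (sqmod a) 0.
    by rewrite a0 mul0r; have := p_le (a *: 0) (a *: y); rewrite g_scale a0 mul0r.
  have a1 : 0 < sqmod a by rewrite lt_neqAle eq_sym a0 sqmod_ge0.
  rewrite -ler_pdivrMl //; apply: (p_ge _ _) => x.
  rewrite ler_pdivrMl // -g_scale; exact: p_le.
have pZ a y : p (a *: y) = sqmod a * p y.
  apply/eqP; rewrite eq_le pZ_le /=.
  have [->|a0] := eqVneq a 0; first by rewrite /sqmod /= expr0n addr0 mul0r.
  (* The reverse inequality is [pZ_le] itself for the scalar [a^-1]. *)
  have := pZ_le a^-1 (a *: y); rewrite scalerA mulVf // scale1r.
  move=> /(ler_wpM2l (sqmod_ge0 a)).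
  by rewrite mulrA [sqmod a * sqmod _]mulrC sqmodV // mul1r.
split=> // y z; apply/eqP; rewrite eq_le half /=.
have := half (y + z) (y - z).
have -> : y + z + (y - z) = (2 : R)%:C%C *: y.
  by rewrite addrACA subrr addr0 rmorphMn scaler_nat mulr2n.
have -> : y + z - (y - z) = (2 : R)%:C%C *: z.
  by rewrite opprB addrC addrA subrK rmorphMn scaler_nat mulr2n.
by rewrite !pZ !sqmod_real; lra.
Qed.
End QuadClosure.

(** * Generalized limits of bounded sequences *)

Section GeneralizedLimit.
Variable R : realType.
Implicit Types u v : nat -> R.

Definition bounded_seq u := exists K : R, forall n, `|u n| <= K.

(** Limit along an ultrafilter finer than the eventual filter: a bounded sequence stays in a compact
    interval, hence converges along it. Outside bounded sequences [lim] may be a default value,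
    whence the boundedness assumptions. *)
Lemma generalized_limit : exists L : (nat -> R) -> R,
  [/\ forall u v, bounded_seq u -> bounded_seq v -> L (fun n => u n + v n) = L u + L v,
      forall c u, bounded_seq u -> L (fun n => c * u n) = c * L u,
      forall c, L (fun=> c) = c &
      forall N u v, bounded_seq u -> bounded_seq v ->
        (forall n, (N <= n)%N -> u n <= v n) -> L u <= L v].
Proof.
have [F [FU ooF]] := ultraFilterLemma (@eventually_filter).
have FP : ProperFilter F by exact: ultra_proper.
have cv u : bounded_seq u -> cvg (u @ F).
  case=> K hK; have : compact (`[-K, K]%classic) by exact: segment_compact.
  move=> /(_ (u @ F) _)[|p [_ clp]].
    have : F (u @^-1` `[- K, K]) by apply: filterS filterT => n _ /=; rewrite in_itv /= -ler_norml.
    by [].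
  apply/cvg_ex; exists p => A /= Ap.
  case: (in_ultra_setVsetC (u @^-1` A)%classic FU) => // FnA.
  by have [q []] := clp (~` A) A FnA Ap.
exists (fun u => lim (u @ F)); split=> [u v bu bv|c u bu|c|N u v bu bv uv].
- by apply: cvg_lim => //; apply: cvgD; exact: cv.
- by apply: cvg_lim => //; apply: cvgM; [exact: cvg_cst|exact: cv].
- by apply: cvg_lim => //; exact: cvg_cst.
- by apply: ler_lim; [exact: cv|exact: cv|apply: ooF; exists N].
Qed.
End GeneralizedLimit.

(** * Hilbert spaces *)

Lemma normr_le_of_sqr (R : realType) (x c : R) : 0 <= c -> x ^+ 2 <= c ^+ 2 -> `|x| <= c.
Proof.
by move=> c0 h; rewrite -(@ler_pXn2r _ 2) ?nnegrE // -normrX ger0_norm ?sqr_ge0.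
Qed.

Section HilbertSpace.
Variables (R : realType) (H : lmodType R[i]) (ip : H -> H -> R[i]).
Hypothesis hH : hilbert_space ip.
Local Notation hnorm := (hnorm ip).

Definition nsq (x : H) : R := complex.Re (ip x x).
Definition rip (x y : H) : R := complex.Re (ip x y).

Lemma ipDl x y z : ip (x + y) z = ip x z + ip y z.
Proof. by case: hH => -[h _ _ _] _; have := h 1 x y z; rewrite scale1r mul1r. Qed.

Lemma ip_conj x y : ip x y = (ip y x)^*.
Proof. by case: hH => -[]. Qed.

Lemma ip0l z : ip 0 z = 0.
Proof. by have := ipDl 0 0 z; rewrite addr0 => /eqP; rewrite -subr_eq subrr => /eqP. Qed.

Lemma ipZl a x z : ip (a *: x) z = a * ip x z.
Proof. by case: hH => -[h _ _ _] _; have := h a x 0 z; rewrite ip0l !addr0. Qed.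

Lemma ipNl x z : ip (- x) z = - ip x z.
Proof. by rewrite -scaleN1r ipZl mulN1r. Qed.

Lemma Re_conj (a : R[i]) : complex.Re a^* = complex.Re a. Proof. by case: a. Qed.

Lemma ripC x y : rip x y = rip y x.
Proof. by rewrite /rip ip_conj Re_conj. Qed.

Lemma ripDl x y z : rip (x + y) z = rip x z + rip y z.
Proof. by rewrite /rip ipDl raddfD. Qed.

Lemma ripNl x z : rip (- x) z = - rip x z.
Proof. by rewrite /rip ipNl raddfN. Qed.

Lemma ripDr x y z : rip z (x + y) = rip z x + rip z y.
Proof. by rewrite !(ripC z) ripDl. Qed.

Lemma ripNr x z : rip z (- x) = - rip z x.
Proof. by rewrite !(ripC z) ripNl. Qed.

Lemma rip0l z : rip 0 z = 0.
Proof. by rewrite /rip ip0l. Qed.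

Lemma ripxx x : rip x x = nsq x.
Proof. by []. Qed.

Lemma nsq_quad : quad nsq.
Proof.
have ge0 x : 0 <= ip x x by case: hH => -[].
split=> [x|x y|a x].
- by have := ge0 x; rewrite lecE => /andP[].
- by rewrite /nsq -!/(rip _ _) !(ripDl, ripDr, ripNl, ripNr); ring.
- rewrite /nsq ipZl (ip_conj x) ipZl rmorphM /= -(ip_conj x x) mulrA -normCK -add_Re2_Im2.
  by have := ger0_Im (ge0 x); case: (ip x x) => u v /= ->; rewrite mulr0 subr0.
Qed.

Lemma polar_nsq x y : polar nsq x y = rip x y.
Proof.
rewrite /polar /nsq -!/(rip _ _) !(ripDl, ripDr, ripNl, ripNr) (ripC y x); lra.
Qed.

Lemma nsq_eq0 x : nsq x = 0 -> x = 0.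
Proof.
move=> h; case: hH => -[_ _ ge0 eq0] _; apply: eq0.
by apply/eqP; rewrite eq_complex /= -/(nsq x) h ger0_Im // !eqxx.
Qed.

Lemma nsq_ge0 x : 0 <= nsq x. Proof. by case: nsq_quad. Qed.

Lemma hnorm_ge0 x : 0 <= hnorm x. Proof. exact: sqrtr_ge0. Qed.

Lemma hnorm_sqr x : hnorm x ^+ 2 = nsq x.
Proof. by rewrite sqr_sqrtr ?nsq_ge0. Qed.

Lemma rip_CS x y : `|rip x y| <= hnorm x * hnorm y.
Proof.
apply: normr_le_of_sqr; first by rewrite mulr_ge0 ?hnorm_ge0.
rewrite exprMn !hnorm_sqr -polar_nsq; apply: polar_CS; exact: nsq_quad.
Qed.

Lemma hnorm_add x y : hnorm (x + y) <= hnorm x + hnorm y.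
Proof.
rewrite -(@ler_pXn2r _ 2) ?nnegrE ?addr_ge0 ?hnorm_ge0 //.
rewrite sqrrD !hnorm_sqr (quadD nsq_quad) polar_nsq.
have := rip_CS x y; rewrite ler_norml => /andP[_]; lra.
Qed.

Lemma hnorm_scale a x : hnorm (a *: x) = Num.sqrt (sqmod a) * hnorm x.
Proof.
have [_ _ nsqZ] := nsq_quad.
by rewrite -sqrtrM ?sqmod_ge0 // -nsqZ.
Qed.

Lemma hnorm_opp x : hnorm (- x) = hnorm x.
Proof. by rewrite /Defs.hnorm -!/(nsq _) (quadN nsq_quad). Qed.

Lemma hnorm_distC x y : hnorm (x - y) = hnorm (y - x).
Proof. by rewrite -hnorm_opp opprB. Qed.

Lemma hnorm_scaler t x : 0 <= t -> hnorm (t%:C%C *: x) = t * hnorm x.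
Proof. by move=> t0; rewrite hnorm_scale sqmod_real sqrtr_sqr ger0_norm. Qed.

Lemma hnorm0 : hnorm 0 = 0.
Proof. by rewrite /Defs.hnorm ip0l sqrtr0. Qed.

Lemma hnorm_eq0 x : hnorm x = 0 -> x = 0.
Proof. by move=> h; apply: nsq_eq0; rewrite -hnorm_sqr h expr0n. Qed.

Lemma hnorm_sum_dist x y z : hnorm (x - z) <= hnorm (x - y) + hnorm (y - z).
Proof. by apply: le_trans (hnorm_add _ _); rewrite addrA subrK. Qed.

Lemma hnorm_le_nsq (M : R) x y : 0 <= M -> nsq x <= M ^+ 2 * nsq y -> hnorm x <= M * hnorm y.
Proof.
move=> M0 h; rewrite -(@ler_pXn2r _ 2) ?nnegrE ?mulr_ge0 ?hnorm_ge0 //.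
by rewrite exprMn !hnorm_sqr.
Qed.

Lemma nsq_le_hnorm (M : R) x y : hnorm x <= M * hnorm y -> nsq x <= M ^+ 2 * nsq y.
Proof.
move=> h; rewrite -!hnorm_sqr -exprMn lerXn2r ?nnegrE ?hnorm_ge0 //.
exact: le_trans (hnorm_ge0 _) h.
Qed.

(* The representing vector minimizes [nsq y - 2 f y]. *)
Lemma riesz (f : H -> R) (M : R) : 0 <= M ->
  (forall x y, f (x + y) = f x + f y) ->
  (forall t x, f (t%:C%C *: x) = t * f x) ->
  (forall x, f x ^+ 2 <= M * nsq x) ->
  exists l, forall v, rip l v = f v.
Proof.
move=> M0 fD fZ fM.
pose J y := nsq y - 2 * f y.
(* From [4 M nsq y <= (M + nsq y) ^ 2] it follows that [2 f y <= M + nsq y]. *)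
have Jlb y : - M <= J y.
  rewrite /J; have [y0|y0] := eqVneq (nsq y) 0.
    have := fM y; rewrite y0 mulr0 => f0.
    have -> : f y = 0 by apply/eqP; rewrite -sqrf_eq0 eq_le f0 sqr_ge0.
    lra.
  have n0 : 0 < nsq y by rewrite lt_neqAle eq_sym y0 nsq_ge0.
  have := fM y; have [fy|fy] := leP (2 * f y) (M + nsq y); first lra.
  have : (M + nsq y) ^+ 2 < (2 * f y) ^+ 2 by rewrite ltrXn2r // ?nnegrE; lra.
  rewrite exprMn; have := sqr_ge0 (M - nsq y); rewrite sqrrB sqrrD; lra.
pose r n : R := n.+1%:R^-1.
have r0 n : 0 < r n by rewrite invr_gt0.
pose m := inf (range J).
have mJ y : m <= J y by apply: ge_inf; [exists (- M) => _ [z _ <-]|exists y].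
have mn n : {y | J y < m + r n}.
  apply: cid; have : m < m + r n by rewrite ltrDl.
  case/inf_lt; first by exists (J 0); exists 0.
  by move=> _ [y _ <-]; exists y.
pose u n := sval (mn n).
have uJ n : J (u n) < m + r n by exact: (svalP (mn n)).
(* Parallelogram law, with [J >= m] at the midpoint of [x] and [y]: minimizing sequences are
   Cauchy. *)
have par x y : nsq (x - y) <= 2 * (J x - m) + 2 * (J y - m).
  have := mJ ((2^-1)%:C%C *: (x + y)); rewrite /J (quad_real nsq_quad) fZ fD.
  have [_ P _] := nsq_quad; have := P x y; rewrite exprVn.
  have -> : (2 : R) ^+ 2 = 4 by ring.
  lra.
have inv_small (e : R) : 0 < e -> exists N, forall n, (N <= n)%N -> r n < e.
  move=> e0; exists (Num.truncn e^-1) => n hn.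
  rewrite /r -[e]invrK ltf_pV2 ?posrE ?invr_gt0 ?ltr0n //.
  by rewrite (lt_le_trans (truncnS_gt _)) // ler_nat.
have cauchy : hcauchy ip u.
  move=> e e0; have [] := inv_small (e ^+ 2 / 4); first by rewrite divr_gt0 ?exprn_gt0.
  move=> N hN; exists N => a b /hN ha /hN hb.
  rewrite -(@ltr_pXn2r _ 2) ?nnegrE ?hnorm_ge0 ?ltW // hnorm_sqr.
  rewrite (le_lt_trans (par _ _)) //; have := uJ a; have := uJ b; lra.
have [l hl] := (proj2 hH) u cauchy.
exists l => v.
(* As [u n] minimizes [J] up to [r n], the polynomial in [disc] is nonnegative; its discriminant
   bounds the derivative of [J] at [u n] along [v]. *)
have approx n : (rip (u n) v - f v) ^+ 2 <= nsq v * r n.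
  have disc (t : R) : 0 <= r n + 2 * t * (rip (u n) v - f v) + t ^+ 2 * nsq v.
    have := mJ (u n + t%:C%C *: v); have := uJ n.
    rewrite /J (quadD nsq_quad) (polarZr nsq_quad) (quad_real nsq_quad) polar_nsq fD fZ.
    lra.
  have := nsq_ge0 v; rewrite le_eqVlt => /orP[/eqP v0|v0].
    have -> : v = 0 by exact: nsq_eq0.
    have -> : f 0 = 0 by have := fD 0 0; rewrite addr0; lra.
    by rewrite ripC /rip ip0l subr0 expr0n mulr_ge0 ?nsq_ge0 // ltW.
  have := disc (- (rip (u n) v - f v) / nsq v).
  set b := rip _ _ - _; set c := nsq v in v0 *; set a := r n.
  have -> : a + 2 * (- b / c) * b + (- b / c) ^+ 2 * c = a - b ^+ 2 / c by field; rewrite gt_eqF.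
  by rewrite subr_ge0 ler_pdivrMr // mulrC.
apply/eqP/negPn/negP => ne.
pose d := `|rip l v - f v|.
have d0 : 0 < d by rewrite normr_gt0 subr_eq0.
have v0 : 0 <= hnorm v := hnorm_ge0 v.
(* Chosen so that two errors [e * hnorm v] add up to less than [d]; the [+ 1] covers [v = 0]. *)
pose e := d / (2 * (hnorm v + 1)).
have e0 : 0 < e by rewrite divr_gt0 // mulr_gt0 //; lra.
have [N1 hN1] := hl e e0; have [N2 hN2] := inv_small (e ^+ 2) (exprn_gt0 _ e0).
pose n := maxn N1 N2.
have h1 : hnorm (u n - l) < e by apply: hN1; rewrite leq_maxl.
have h2 : r n < e ^+ 2 by apply: hN2; rewrite leq_maxr.
have h3 : `|rip (u n) v - f v| <= e * hnorm v.
  apply: normr_le_of_sqr; first by rewrite mulr_ge0 // ltW.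
  rewrite exprMn hnorm_sqr mulrC (le_trans (approx n)) // ler_wpM2l ?nsq_ge0 //.
  exact: ltW.
have h4 : `|rip (u n - l) v| <= e * hnorm v.
  by rewrite (le_trans (rip_CS _ _)) // ler_wpM2r // ltW.
have : d <= 2 * (e * hnorm v).
  rewrite /d; have -> : rip l v - f v = (rip (u n) v - f v) - rip (u n - l) v.
    by rewrite ripDl ripNl; ring.
  by rewrite (le_trans (ler_normB _ _)) //; lra.
have -> : 2 * (e * hnorm v) = d * (hnorm v / (hnorm v + 1)) by
  rewrite /e; field; rewrite gt_eqF //; lra.
rewrite leNgt => /negP; apply.
by rewrite gtr_pMr // ltr_pdivrMr; lra.
Qed.

End HilbertSpace.

(** * Square roots of positive operators *)

Lemma geometric_le (R : realType) (r K a b : R) : 0 <= r < 1 ->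
  (forall n, a <= b + K * r ^+ n) -> a <= b.
Proof.
move=> /andP[r0 r1] h; have r1' : `|r| < 1 by rewrite ger0_norm.
have cv : b + K * r ^+ n @[n --> \oo] --> b + K * 0.
  apply: cvgD; first exact: cvg_cst.
  by apply: cvgM; [exact: cvg_cst|exact: cvg_expr].
rewrite mulr0 addr0 in cv.
by apply: (@ler_cvg_to _ _ _ _ (fun=> a) _ _ _ (cvg_cst _) cv); exact: nearW.
Qed.

Section SquareRoot.
Variables (R : realType) (H : lmodType R[i]) (ip : H -> H -> R[i]).
Hypothesis hH : hilbert_space ip.
Local Notation hnorm := (hnorm ip).
Local Notation nsq := (nsq ip).
Local Notation rip := (rip ip).

Section LinOp.
Variables (A : H -> H) (hA : lin_op A).

Lemma lin_op0 : A 0 = 0.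
Proof. by have := hA (-1) 0 0; rewrite scaler0 addr0 scaleN1r addNr. Qed.

Lemma lin_opD x y : A (x + y) = A x + A y.
Proof. by have := hA 1 x y; rewrite !scale1r. Qed.

Lemma lin_opZ a x : A (a *: x) = a *: A x.
Proof. by have := hA a x 0; rewrite lin_op0 !addr0. Qed.

Lemma lin_opB x y : A (x - y) = A x - A y.
Proof. by rewrite lin_opD -scaleN1r lin_opZ scaleN1r. Qed.
End LinOp.

Lemma polarZc (p : H -> R) a x y : quad p ->
  polar p (a *: x) y = complex.Re a * polar p x y - complex.Im a * polar p x ('i%C *: y).
Proof.
move=> hp; rewrite [a in LHS]complexE scalerDl -scalerA (polarDl hp) (polarZl hp).
by rewrite (polaril hp) (polarZl hp).
Qed.

Lemma rip_ext x y : (forall v, rip x v = rip y v) -> x = y.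
Proof.
move=> h; apply/eqP; rewrite -subr_eq0; apply/eqP/(nsq_eq0 hH).
by rewrite -ripxx (ripDl hH) (ripNl hH) h subrr.
Qed.

(** [B x] represents [polar p x] by Riesz. Complex linearity holds because [rip] and [polar p] obey
    the same rule [polarZc]; the norm bound is Cauchy-Schwarz at [x] and [B x]. *)
Lemma quad_operator (p : H -> R) (q : R) : quad p -> 0 <= q ->
  (forall x, p x <= q * nsq x) ->
  exists B, [/\ lin_op B, forall x y, rip (B x) y = polar p x y &
    forall x, hnorm (B x) <= q * hnorm x].
Proof.
move=> hp q0 pq; have [p0 _ _] := hp.
have ex x : exists l, forall v, rip l v = polar p x v.
  have M0 : 0 <= q * p x by rewrite mulr_ge0.
  apply: (riesz hH M0) => [u v|t u|u].
  - by rewrite (polarDr hp).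
  - by rewrite (polarZr hp).
  - by rewrite (le_trans (polar_CS hp _ _)) // (mulrC q) -mulrA ler_wpM2l.
have [B hB] := choice ex; exists B; split=> // [a x y|x].
  apply: rip_ext => v; rewrite hB (polarDl hp) (ripDl hH) hB; congr (_ + _).
  by rewrite -(polar_nsq hH) !polarZc ?(polar_nsq hH) ?hB //; exact: nsq_quad.
apply: (hnorm_le_nsq hH) => //.
have := polar_CS hp x (B x); rewrite -hB -/(nsq (B x)).
have := nsq_ge0 hH (B x); rewrite le_eqVlt => /orP[/eqP<- _|b0 h].
  by rewrite mulr_ge0 ?sqr_ge0 // (nsq_ge0 hH).
rewrite -(ler_pM2r b0) -expr2 (le_trans h) //.
have -> : q ^+ 2 * nsq x * nsq (B x) = (q * nsq x) * (q * nsq (B x)) by ring.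
by rewrite ler_pM.
Qed.

(** * Convergence at a geometric rate *)

Section Geometric.
Variables (r : R) (r01 : 0 <= r < 1).

Definition geometric_cvg (u : nat -> H) (l : H) :=
  exists K : R, forall n, hnorm (u n - l) <= K * r ^+ n.

Lemma geometric_cvg_unique u l l' : geometric_cvg u l -> geometric_cvg u l' -> l = l'.
Proof.
move=> [K hK] [K' hK']; apply/eqP; rewrite -subr_eq0; apply/eqP/(hnorm_eq0 hH).
apply/eqP; rewrite eq_le hnorm_ge0 andbT.
apply: (geometric_le (K := K + K') r01) => n; rewrite add0r mulrDl.
by rewrite (le_trans (hnorm_sum_dist hH _ (u n) _)) // lerD ?hK' // (hnorm_distC hH) hK.
Qed.

Lemma geometric_cvgD u v l m : geometric_cvg u l -> geometric_cvg v m ->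
  geometric_cvg (fun n => u n + v n) (l + m).
Proof.
move=> [K hK] [K' hK']; exists (K + K') => n.
by rewrite opprD addrACA mulrDl (le_trans (hnorm_add hH _ _)) // lerD.
Qed.

Lemma geometric_cvgZ a u l : geometric_cvg u l -> geometric_cvg (fun n => a *: u n) (a *: l).
Proof.
move=> [K hK]; exists (Num.sqrt (sqmod a) * K) => n.
by rewrite -scalerBr (hnorm_scale hH) -mulrA ler_wpM2l ?sqrtr_ge0.
Qed.

Lemma geometric_cvg_cst l : geometric_cvg (fun=> l) l.
Proof. by exists 0 => n; rewrite subrr (hnorm0 hH) mul0r. Qed.

Lemma geometric_cvgS u l : geometric_cvg u l -> geometric_cvg (fun n => u n.+1) l.
Proof.
by move=> [K hK]; exists (K * r) => n; rewrite -mulrA -exprS.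
Qed.

(** The uniform bound [c] lets operator and argument vary together, as needed for the squares
    [Yn n (Yn n x)]. *)
Lemma geometric_cvg_op (A : nat -> H -> H) (c : R) u l m : 0 <= c ->
  (forall n, lin_op (A n)) -> (forall n x, hnorm (A n x) <= c * hnorm x) ->
  geometric_cvg u l -> geometric_cvg (fun n => A n l) m -> geometric_cvg (fun n => A n (u n)) m.
Proof.
move=> c0 Alin Ac [K hK] [K' hK']; exists (c * K + K') => n; rewrite mulrDl.
rewrite (le_trans (hnorm_sum_dist hH _ (A n l) _)) // lerD ?hK' // -(lin_opB (Alin n)).
by rewrite (le_trans (Ac _ _)) // -mulrA ler_wpM2l.
Qed.

Lemma geometric_cvg_hnorm_le (u : nat -> H) l b :
  geometric_cvg u l -> (forall n, hnorm (u n) <= b) -> hnorm l <= b.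
Proof.
move=> [K hK] ub; apply: (geometric_le (K := K) r01) => n.
have := hnorm_sum_dist hH l (u n) 0; rewrite !subr0 => /le_trans; apply.
by rewrite addrC lerD // (hnorm_distC hH) hK.
Qed.

Lemma geometric_cvg_rip u l y z : geometric_cvg u l -> (forall n, rip (u n) y = z n) ->
  exists K : R, forall n, `|z n - rip l y| <= K * r ^+ n.
Proof.
move=> [K hK] uz; exists (K * hnorm y) => n.
rewrite -uz -(ripNl hH) -(ripDl hH) (le_trans (rip_CS hH _ _)) // mulrAC.
by rewrite ler_wpM2r ?hnorm_ge0.
Qed.

Lemma geometric_cvg_series u (C : R) : (forall n, hnorm (u n.+1 - u n) <= C * r ^+ n) ->
  exists l, geometric_cvg u l.
Proof.
move=> hu; have /andP[r0 r1] := r01.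
have C0 : 0 <= C by have := hu 0%N; rewrite expr0 mulr1; apply: le_trans; exact: hnorm_ge0.
pose D := C / (1 - r).
have D0 : 0 <= D by rewrite divr_ge0 // subr_ge0 ltW.
(* The exact partial geometric sum is kept so that the induction closes; [tail] then drops the
   negative term. *)
have tele n k : hnorm (u (n + k)%N - u n) <= D * (r ^+ n - r ^+ (n + k)).
  elim: k => [|k IH]; first by rewrite addn0 !subrr (hnorm0 hH) mulr0.
  rewrite addnS (le_trans (hnorm_sum_dist hH _ (u (n + k)%N) _)) //.
  have -> : D * (r ^+ n - r ^+ (n + k).+1) =
      C * r ^+ (n + k) + D * (r ^+ n - r ^+ (n + k)).
    by rewrite exprS /D; field; rewrite subr_eq0 gt_eqF.
  by rewrite lerD.
have tail n k : hnorm (u (n + k)%N - u n) <= D * r ^+ n.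
  by rewrite (le_trans (tele n k)) // ler_wpM2l // gerBl exprn_ge0.
have [l hl] : hconverges ip u.
  apply: (proj2 hH) => e e0.
  have [N hN] : exists N, 2 * D * r ^+ N < e.
    apply: contrapT => hno; suff : e <= 0 by rewrite leNgt e0.
    apply: (geometric_le (K := 2 * D) r01) => n; rewrite add0r leNgt; apply/negP => hn.
    by apply: hno; exists n.
  exists N => m n /subnKC <- /subnKC <-.
  rewrite (le_lt_trans (hnorm_sum_dist hH _ (u N) _)) // (le_lt_trans _ hN) //.
  have -> : 2 * D * r ^+ N = D * r ^+ N + D * r ^+ N by ring.
  by rewrite lerD ?tail // (hnorm_distC hH) tail.
(* The distance to [l] is estimated through the term of index [n + N], and [e] is arbitrary. *)
exists l, D => n; apply/ler_addgt0Pr => e e0; have [N hN] := hl e e0.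
rewrite (le_trans (hnorm_sum_dist hH _ (u (n + N)%N) _)) // lerD //.
  by rewrite (hnorm_distC hH) tail.
by rewrite ltW // hN // leq_addl.
Qed.

End Geometric.

(* [S = 1 - Y], where [Y = (B + Y ^ 2) / 2] is obtained by iteration and [B] is
   the operator of [p]; thus [S ^ 2 = 1 - B]. *)
Lemma sqrt_operator (p : H -> R) (q : R) : quad p -> 0 <= q < 1 ->
  (forall x, p x <= q * nsq x) ->
  exists S Si, invertible_with ip S Si /\ forall x, nsq (S x) = nsq x - p x.
Proof.
move=> hp q01 pq; have /andP[q0 q1] := q01.
have [B [Blin Bp Bq]] := quad_operator hp q0 pq.
have half0 : 0 <= 2^-1 :> R by rewrite invr_ge0.
pose Yn := fix Yn n := if n is n'.+1 then
  fun x => (2^-1)%:C%C *: (B x + Yn n' (Yn n' x)) else fun=> (0 : H).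
have YnS n x : Yn n.+1 x = (2^-1)%:C%C *: (B x + Yn n (Yn n x)) by [].
have Ynlin n : lin_op (Yn n).
  elim: n => [|n IH] a x y; first by rewrite /= scaler0 addr0.
  rewrite !YnS !(Blin, IH) scalerA mulrC -scalerA -scalerDr; congr (_ *: _).
  by rewrite scalerDr addrACA.
(* The bound is preserved since [(q + q ^ 2) / 2 <= q]. *)
have Ynq n x : hnorm (Yn n x) <= q * hnorm x.
  elim: n x => [|n IH] x; first by rewrite /= (hnorm0 hH) mulr_ge0 ?hnorm_ge0.
  rewrite YnS (hnorm_scaler hH) // ler_pdivrMl //.
  rewrite (le_trans (hnorm_add hH _ _)) // mulr_natl mulr2n lerD // (le_trans (IH _)) //.
  rewrite (le_trans (ler_wpM2l q0 (IH x))) // ler_piMl ?mulr_ge0 ?hnorm_ge0 //.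
  exact: ltW.
have Ynself n x y : rip (Yn n x) y = rip x (Yn n y).
  elim: n x y => [|n IH] x y; first by rewrite /= (ripC hH x) !(rip0l hH).
  rewrite !YnS -!(polar_nsq hH) (polarZl (nsq_quad hH)) (polarZr (nsq_quad hH)).
  by rewrite !(polar_nsq hH) (ripDl hH) (ripDr hH) !IH Bp (ripC hH x (B y)) Bp (polarC hp).
have Yndiff n x : hnorm (Yn n.+1 x - Yn n x) <= q * hnorm x * q ^+ n.
  elim: n x => [|n IH] x.
    rewrite YnS /= subr0 addr0 expr0 mulr1 (hnorm_scaler hH) //.
    rewrite ler_pdivrMl // (le_trans (Bq x)) // ler_peMl ?mulr_ge0 ?hnorm_ge0 //.
    by rewrite ler1n.
  rewrite YnS [Yn n.+1 x in X in _ - X]YnS -scalerBr opprD addrACA subrr add0r (hnorm_scaler hH) //.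
  rewrite ler_pdivrMl //.
  (* A difference of squares without commutation: each of the two terms gains a factor [q], and the
     half in front absorbs their sum. *)
  have -> : Yn n.+1 (Yn n.+1 x) - Yn n (Yn n x) =
    Yn n.+1 (Yn n.+1 x - Yn n x) + (Yn n.+1 (Yn n x) - Yn n (Yn n x)).
    by rewrite (lin_opB (Ynlin _)) addrA subrK.
  rewrite (le_trans (hnorm_add hH _ _)) // mulr_natl mulr2n exprS lerD //.
    by rewrite (le_trans (Ynq _ _)) // mulrCA ler_wpM2l.
  rewrite (le_trans (IH _)) // mulrA ler_wpM2r ?exprn_ge0 //.
  by rewrite -mulrA ler_wpM2l // mulrC Ynq.
have [Y hY] := choice (fun x => geometric_cvg_series q01 (fun n => Yndiff n x)).
have Ylin : lin_op Y.
  move=> a x y; apply: (geometric_cvg_unique q01 (hY _)).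
  have [K hK] := geometric_cvgD (geometric_cvgZ a (hY x)) (hY y).
  by exists K => n; rewrite Ynlin.
have Yq x : hnorm (Y x) <= q * hnorm x by apply: (geometric_cvg_hnorm_le q01 (hY x)) => n.
have YE x : (2 : R)%:C%C *: Y x = B x + Y (Y x).
  have hYY := geometric_cvg_op q0 Ynlin Ynq (hY x) (hY (Y x)).
  have h1 := geometric_cvgD (geometric_cvg_cst q (B x)) hYY.
  apply: (geometric_cvg_unique q01 _ h1);
  have [K hK] := geometric_cvgZ (2 : R)%:C%C (geometric_cvgS (hY x)).
  exists K => n; have := hK n; rewrite YnS scalerA -rmorphM divff ?pnatr_eq0 //.
  by rewrite rmorph1 scale1r.
have Yself x y : rip (Y x) y = rip x (Y y).
  have [K hK] := geometric_cvg_rip (hY x) (fun n => Ynself n x y).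
  have [K' hK'] := geometric_cvg_rip (hY y) (fun n => erefl (rip (Yn n y) x)).
  apply/eqP; rewrite -subr_eq0 -normr_eq0 eq_le normr_ge0 andbT.
  apply: (geometric_le (K := K + K') q01) => n; rewrite add0r mulrDl.
  have -> : rip (Y x) y - rip x (Y y) =
    - (rip x (Yn n y) - rip (Y x) y) + (rip (Yn n y) x - rip (Y y) x).
    by rewrite (ripC hH (Yn n y)) (ripC hH (Y y)); ring.
  by rewrite (le_trans (ler_normD _ _)) // normrN lerD.
pose S x := x - Y x.
have Slin : lin_op S.
  by move=> a x y; rewrite /S Ylin scalerBr opprD addrACA.
(* Lower bound giving both injectivity of [S] and the bound of its inverse. *)
have Slow x : (1 - q) * hnorm x <= hnorm (S x).
  have := hnorm_add hH (S x) (Y x); rewrite /S subrK; have := Yq x; lra.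
have Sinj x y : S x = S y -> x = y.
  move=> e; apply/eqP; rewrite -subr_eq0; apply/eqP/(hnorm_eq0 hH)/eqP.
  rewrite eq_le hnorm_ge0 andbT.
  have := Slow (x - y); rewrite (lin_opB Slin) e subrr (hnorm0 hH).
  by rewrite pmulr_rle0 // subr_gt0.
have Ssurj z : exists x, S x = z.
  (* Neumann iteration for [x = z + Y x]. *)
  pose u := fix u n := if n is n'.+1 then z + Y (u n') else (0 : H).
  have uS n : u n.+1 = z + Y (u n) by [].
  have [|l hl] := @geometric_cvg_series q q01 u (hnorm z).
    elim=> [|n IH]; first by rewrite /= (lin_op0 Ylin) addr0 subr0 expr0 mulr1.
    rewrite !uS opprD addrACA subrr add0r -(lin_opB Ylin) (le_trans (Yq _)) //.
    by rewrite exprS mulrCA ler_wpM2l.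
  exists l; have hYl : geometric_cvg q (fun n => u n.+1) (z + Y l).
    exact: geometric_cvgD (geometric_cvg_cst q z)
      (geometric_cvg_op q0 (fun=> Ylin) (fun=> Yq) hl (geometric_cvg_cst q _)).
  by rewrite /S [X in X - _](geometric_cvg_unique q01 (geometric_cvgS hl) hYl) addrK.
have [Si SSi] := choice Ssurj; exists S, Si; split; last first.
  move=> x; have -> : p x = 2 * rip (Y x) x - rip (Y (Y x)) x.
    have -> : p x = rip (B x) x by rewrite Bp (polarxx hp).
    have <- : (2 : R)%:C%C *: Y x - Y (Y x) = B x by rewrite YE addrK.
    rewrite (ripDl hH) (ripNl hH); congr (_ - _).
    by rewrite -(polar_nsq hH) (polarZl (nsq_quad hH)) (polar_nsq hH).
  rewrite /S (quadB (nsq_quad hH)) (polar_nsq hH) (Yself (Y x)) (Yself x).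
  by rewrite -/(nsq (Y x)); ring.
split=> // [||x].
- split=> //; exists (1 + q) => x; rewrite mulrDl mul1r.
  by rewrite (le_trans (hnorm_add hH _ _)) // (hnorm_opp hH) lerD.
- split=> [a x y|]; first by apply: Sinj; rewrite Slin !SSi.
  exists (1 - q)^-1 => x; rewrite ler_pdivlMl ?subr_gt0 //.
  by rewrite (le_trans (Slow _)) // SSi.
- by apply: Sinj; rewrite SSi.
Qed.

(** For [D] large, [1 - N / D] lies between 0 and [1 - c / D < 1], so [sqrt_operator] provides a
    square root of [N / D]; it is rescaled by the square root of [D]. *)
Lemma quad_renorm (N : H -> R) (c C : R) : quad N -> 0 < c ->
  (forall x, c * nsq x <= N x <= C * nsq x) ->
  exists S Si, invertible_with ip S Si /\ forall x, nsq (S x) = N x.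
Proof.
move=> hN c0 cNC; have [_ _ NZ] := nsq_quad hH.
pose D := c + `|C|; have D0 : 0 < D by rewrite ltr_wpDr.
have ND x : N x <= D * nsq x.
  have /andP[_ /le_trans] := cNC x; apply; rewrite ler_wpM2r ?(nsq_ge0 hH) //.
  by rewrite (le_trans (ler_norm C)) // lerDr ltW.
have Di0 : 0 <= D^-1 by rewrite invr_ge0 ltW.
have hp : quad (fun x => nsq x - D^-1 * N x).
  apply: quad_sub; [exact: nsq_quad|exact: quad_scale|move=> x].
  by rewrite ler_pdivrMl.
have [||S0 [S0i [[S0b S0ib S0K S0iK] S0N]]] := @sqrt_operator _ (1 - c / D) hp.
- by rewrite subr_ge0 ler_pdivrMr // mul1r lerDl normr_ge0 /= gtrBl divr_gt0.
- move=> x; have /andP[h _] := cNC x.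
  by rewrite mulrBl mul1r lerD2l lerN2 mulrAC mulrC ler_wpM2l.
pose s := Num.sqrt D; have s0 : 0 < s by rewrite sqrtr_gt0.
have s2 : s ^+ 2 = D by rewrite sqr_sqrtr // ltW.
have sV : (s%:C%C)^-1 = (s^-1)%:C%C :> R[i] by rewrite fmorphV.
have sC : s%:C%C != 0 :> R[i] by rewrite fmorph_eq0 gt_eqF.
have [S0lin [M hM]] := S0b; have [S0ilin [M' hM']] := S0ib.
exists (fun x => s%:C%C *: S0 x), (fun x => S0i ((s^-1)%:C%C *: x)); split.
  split=> [||x|x].
  - split=> [a x y|]; first by rewrite S0lin scalerDr !scalerA mulrC.
    exists (s * M) => x; rewrite (hnorm_scaler hH _ (ltW s0)) -mulrA.
    by rewrite ler_pM2l.
  - split=> [a x y|].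
      by rewrite scalerDr !scalerA mulrC -scalerA S0ilin.
    exists (M' * s^-1) => x; rewrite (le_trans (hM' _)) //.
    by rewrite (hnorm_scaler hH) ?mulrA // invr_ge0 ltW.
  - by rewrite scalerA -sV mulVf // scale1r S0K.
  - by rewrite S0iK scalerA -sV mulfV // scale1r.
move=> x; rewrite NZ sqmod_real s2 S0N opprB addrC subrK mulrA divff ?mul1r //.
by rewrite gt_eqF.
Qed.
End SquareRoot.

(** * Renorming the semigroup *)

Section Semigroup.
Variables (R : realType) (H : lmodType R[i]) (ip : H -> H -> R[i]).
Hypothesis hH : hilbert_space ip.
Variables (T : R -> H -> H) (hT : C0_semigroup ip T).
Local Notation hnorm := (hnorm ip).
Local Notation nsq := (nsq ip).

Lemma sg_lin t : 0 <= t -> lin_op (T t).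
Proof. by case: hT => h _ _ _ /h[]. Qed.

Lemma sg0 x : T 0 x = x. Proof. by case: hT. Qed.

Lemma sgD s t x : 0 <= s -> 0 <= t -> T (s + t) x = T s (T t x).
Proof. by case: hT => _ _ h _ *; apply: h. Qed.

Variables (q1 q2 : H -> R) (tau k lam : R).
Hypotheses (q1_quad : quad q1) (q2_quad : quad q2) (tau0 : 0 < tau) (k0 : 0 < k)
  (lam0 : 0 <= lam).
Hypotheses (q1_le : forall x, q1 x <= k * nsq x) (q1_ge : forall x, nsq x <= k * q1 x)
  (q2_le : forall x, q2 x <= k * nsq x) (q2_ge : forall x, nsq x <= k * q2 x).
Hypothesis q1_tau : forall x, q1 (T tau x) <= q1 x.
Local Notation E t := (expR (2 * lam * t)).
Hypothesis q2_sg : forall (t : R) x, 0 <= t -> q2 (T t x) <= E t * q2 x.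

Let q1_ge0 x : 0 <= q1 x. Proof. by case: q1_quad. Qed.
Let q2_ge0 x : 0 <= q2 x. Proof. by case: q2_quad. Qed.
Let e := E tau.
Let ED s t : E (s + t) = E s * E t. Proof. by rewrite mulrDr expRD. Qed.
Let E_ge1 t : 0 <= t -> 1 <= E t.
Proof.
move=> t0; apply: le_trans (expR_ge1Dx _); rewrite lerDl.
by rewrite !mulr_ge0.
Qed.
Let E_le t : t <= tau -> E t <= e.
Proof. by move=> t1; rewrite ler_expR ler_wpM2l // mulr_ge0. Qed.
Let e1 : 1 <= e. Proof. by apply: E_ge1; exact: ltW. Qed.

(** Stated on pairs so that [quad_inf] applies. The weight [(E t)^-1] offsets the growth of [q2]
    along the semigroup. *)
Let g t (xy : H * H) : R :=
  (q1 xy.1 - q1 (T tau xy.1)) + (E t)^-1 * q2 (xy.2 - T t xy.1).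

(* The infimum pays for the part of [y] which is not of the form [T t x] with
   [q1 x] close to [q1 (T tau x)]: it keeps [moving_quad] bounded below on
   vectors that [T (tau - t)] almost kills. *)
Definition moving_quad (t : R) (y : H) : R :=
  q1 (T (tau - t) y) + inf [set g t (x, y) | x in setT].

Let g_ge0 t xy : 0 <= g t xy.
Proof. by rewrite addr_ge0 ?subr_ge0 // mulr_ge0 // invr_ge0 expR_ge0. Qed.

Let inf_le t x y : inf [set g t (x, y) | x in setT] <= g t (x, y).
Proof. by apply: ge_inf; [exists 0 => _ [z _ <-]|exists x]. Qed.

Let le_inf t y c : (forall x, c <= g t (x, y)) -> c <= inf [set g t (x, y) | x in setT].
Proof.
by move=> h; apply: lb_le_inf => [|_ [z _ <-] //]; exists (g t (0, y)); exists 0.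
Qed.

Lemma moving_quadP t : 0 <= t <= tau -> quad (moving_quad t).
Proof.
move=> /andP[t0 t1]; apply: quad_add.
  by apply: quad_comp => //; apply: sg_lin; rewrite subr_ge0.
apply: quad_inf; apply: quad_add.
  apply: (@quad_comp _ _ _ (fun x => q1 x - q1 (T tau x)) fst) => //.
  apply: quad_sub => //; apply: quad_comp => //; apply: sg_lin; exact: ltW.
apply: quad_scale; first by rewrite invr_ge0 expR_ge0.
apply: (@quad_comp _ _ _ q2 (fun xy : H * H => xy.2 - T t xy.1)) => // a x y /=.
by rewrite (sg_lin t0) opprD addrACA scalerBr.
Qed.

(** The first term is unchanged since [T (tau - t - s)] after [T s] is [T (tau - t)]. In the infimum
    the same [x] competes, and the factor [E s] lost by [q2] is returned by the weight. *)
Lemma moving_quad_step s t y : 0 <= s -> 0 <= t -> t + s <= tau ->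
  moving_quad (t + s) (T s y) <= moving_quad t y.
Proof.
move=> s0 t0 ts; rewrite /moving_quad -sgD ?subr_ge0 //.
have -> : tau - (t + s) + s = tau - t by ring.
rewrite lerD2l; apply: le_inf => x; apply: le_trans (inf_le _ x _) _.
rewrite /g /= lerD2l (addrC t s) ED invfM [(E s)^-1 * _]mulrC.
rewrite -[_ / E s * _]mulrA ler_wpM2l ?invr_ge0 ?expR_ge0 //.
rewrite ler_pdivrMl ?expR_gt0 // (sgD x s0 t0) -(lin_opB (sg_lin s0)).
exact: q2_sg.
Qed.

(** The competitor [x = y] makes the two values at [T tau y] cancel. With [moving_quad_tau] this
    closes the cycle: the form at time 0 is below the one at time [tau]. *)
Lemma moving_quad0 y : moving_quad 0 y <= q1 y.
Proof.
have := inf_le 0 y y.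
rewrite /moving_quad /g /= subr0 sg0 subrr (quad0 q2_quad) !mulr0 addr0; lra.
Qed.

Lemma moving_quad_tau y : q1 y <= moving_quad tau y.
Proof. by rewrite /moving_quad subrr sg0 lerDl; apply: le_inf. Qed.

Let q1_sg t x : 0 <= t <= tau -> q1 (T t x) <= k ^+ 2 * e * q2 x.
Proof.
move=> /andP[t0 t1]; rewrite (le_trans (q1_le _)) // expr2 -!mulrA ler_pM2l //.
rewrite (le_trans (q2_ge _)) // ler_pM2l // (le_trans (q2_sg _ t0)) //.
by rewrite ler_wpM2r // E_le.
Qed.

Lemma moving_quad_le t y : 0 <= t <= tau ->
  moving_quad t y <= (k ^+ 2 * e + 1) * k * nsq y.
Proof.
move=> /andP[t0 t1]; have := inf_le t 0 y; rewrite /g /=.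
rewrite (lin_op0 (sg_lin t0)) (lin_op0 (sg_lin (ltW tau0))) subrr add0r subr0 => h.
have h1 : q1 (T (tau - t) y) <= k ^+ 2 * e * q2 y.
  by apply: q1_sg; rewrite subr_ge0 t1 gerBl.
have h2 : (E t)^-1 * q2 y <= q2 y by rewrite ler_piMl // invf_le1 ?expR_gt0 // E_ge1.
have h3 : (k ^+ 2 * e + 1) * q2 y <= (k ^+ 2 * e + 1) * (k * nsq y).
  by rewrite ler_wpM2l // addr_ge0 // mulr_ge0 ?expR_ge0 ?sqr_ge0.
rewrite /moving_quad -mulrA; lra.
Qed.

(** For each competitor [x], the terms [a], [d], [b] control in turn [z = y - T t x],
    [T tau x = T (tau - t) y - T (tau - t) z], then [x] through [d], then [T t x], and finally
    [y]. *)
Lemma moving_quad_ge : exists2 c : R, 0 < c &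
  forall t y, 0 <= t <= tau -> c * nsq y <= moving_quad t y.
Proof.
(* Collects the constants of the chain, with the final estimate taken linear in [a + d + b]; it does
   not depend on [t]. *)
pose M := k * (2 * e + 2 * (e * k ^+ 2) * (3 + 2 * (k ^+ 2 * e ^+ 2))).
have e0 : 0 < e := expR_gt0 _.
have M0 : 0 < M by rewrite mulr_gt0 // addr_gt0 ?mulr_gt0 ?addr_gt0 ?mulr_gt0 ?exprn_gt0.
exists M^-1; first by rewrite invr_gt0.
move=> t y /andP[t0 t1]; rewrite /moving_quad -lerBlDl; apply: le_inf => x.
rewrite lerBlDl ler_pdivrMl // /g /=.
set a := q1 _; set d := q1 x - _; set z := y - _; set b := _ * q2 z.
have a0 : 0 <= a by exact: q1_ge0.
have d0 : 0 <= d by rewrite subr_ge0.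
have b0 : 0 <= b by rewrite mulr_ge0 // invr_ge0 expR_ge0.
have zb : q2 z <= e * b.
  rewrite /b mulrA ler_peMl // -ler_pdivrMr ?invr_gt0 ?expR_gt0 //.
  by rewrite invrK mul1r E_le.
have taut : 0 <= tau - t <= tau by rewrite subr_ge0 t1 gerBl.
have Tz : q1 (T (tau - t) z) <= k ^+ 2 * e ^+ 2 * b.
  have ke0 : 0 <= k ^+ 2 * e by rewrite mulr_ge0 ?sqr_ge0 // ltW.
  by rewrite (le_trans (q1_sg _ taut)) //; have := ler_wpM2l ke0 zb; lra.
have Ax : q1 (T tau x) <= 2 * a + 2 * (k ^+ 2 * e ^+ 2 * b).
  have -> : T tau x = T (tau - t) y + - T (tau - t) z.
    have /andP[h _] := taut; rewrite /z (lin_opB (sg_lin h)) opprB addrC subrK.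
    by rewrite -sgD // subrK.
  rewrite (le_trans (quadD_le q1_quad _ _)) // (quadN q1_quad) -/a; lra.
have x1 : q1 x <= d + (2 * a + 2 * (k ^+ 2 * e ^+ 2 * b)) by rewrite /d; lra.
have Tx : q2 (T t x) <= e * k ^+ 2 * q1 x.
  have q21 : q2 x <= k ^+ 2 * q1 x by rewrite (le_trans (q2_le _)) // expr2 -mulrA ler_pM2l.
  apply: le_trans (q2_sg x t0) _.
  by have := ler_pM (expR_ge0 _) (q2_ge0 x) (E_le t1) q21; rewrite mulrA.
have ek0 : 0 <= e * k ^+ 2 by rewrite mulr_ge0 ?sqr_ge0 // ltW.
have q2y : q2 y <= 2 * q2 z + 2 * q2 (T t x).
  by have := quadD_le q2_quad z (T t x); rewrite /z subrK.
have /(ler_wpM2l (ltW k0)) ky : q2 y <= 2 * (e * b) +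
    2 * (e * k ^+ 2 * (d + (2 * a + 2 * (k ^+ 2 * e ^+ 2 * b)))).
  by have := ler_wpM2l ek0 x1; lra.
apply: le_trans (q2_ge y) _; apply: le_trans ky _; rewrite /M -[leRHS]mulrA ler_pM2l //.
set K := k ^+ 2 * e ^+ 2 in Tz Ax x1 *; set F := e * k ^+ 2 in Tx ek0 *.
have K0 : 0 <= K by rewrite mulr_ge0 ?sqr_ge0.
have ha : 0 <= e * a by rewrite mulr_ge0 // ltW.
have hd : 0 <= e * d by rewrite mulr_ge0 // ltW.
have Fa : 0 <= F * a := mulr_ge0 ek0 a0.
have Fd : 0 <= F * d := mulr_ge0 ek0 d0.
have Fb : 0 <= F * b := mulr_ge0 ek0 b0.
have KFa : 0 <= F * K * a := mulr_ge0 (mulr_ge0 ek0 K0) a0.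
have KFd : 0 <= F * K * d := mulr_ge0 (mulr_ge0 ek0 K0) d0.
have KFb : 0 <= F * K * b := mulr_ge0 (mulr_ge0 ek0 K0) b0.
lra.
Qed.
End Semigroup.

(** * Averages over finer and finer grids, and their limit *)

Section ContractiveRenorming.
Variables (R : realType) (H : lmodType R[i]) (ip : H -> H -> R[i]).
Hypothesis hH : hilbert_space ip.
Variables (T : R -> H -> H) (hT : C0_semigroup ip T).
Local Notation nsq := (nsq ip).

Section Average.
Variables (w : R -> H -> R) (tau : R).
Hypotheses (tau0 : 0 < tau) (w_quad : forall t, 0 <= t <= tau -> quad (w t))
  (w_step : forall s t y, 0 <= s -> 0 <= t -> t + s <= tau -> w (t + s) (T s y) <= w t y)
  (w_wrap : forall y, w 0 y <= w tau y).

Let h n : R := tau / n.+1%:R.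
Let h_gt0 n : 0 < h n. Proof. by rewrite divr_gt0. Qed.
Let hE n : h n *+ n.+1 = tau.
Proof. by rewrite -(mulr_natr (h n)) /h -mulrA mulVf ?mulr1 // pnatr_eq0. Qed.
Let grid n k : (k <= n.+1)%N -> 0 <= h n *+ k <= tau.
Proof.
move=> kn; rewrite mulrn_wge0 ?(ltW (h_gt0 n)) //= -[leRHS](hE n).
by rewrite ler_wpMn2l // ltW.
Qed.

(** Left Riemann sum for the mean of [w] over [0, tau], with [n.+1] nodes so that [n = 0] is
    meaningful. *)
Definition average n y : R := n.+1%:R^-1 * \sum_(k < n.+1) w (h n *+ k) y.

Lemma average_quad n : quad (average n).
Proof.
apply: quad_scale; first by rewrite invr_ge0.
by apply: (quad_sum (p := fun k => w (h n *+ k))) => k kn; apply/w_quad/grid/ltnW.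
Qed.

(** [w_step] moves each node to the next one. The node 0 is left over; [w_wrap] trades it for the
    node [tau] reached from the last one. *)
Lemma average_step n y : average n (T (h n) y) <= average n y.
Proof.
rewrite ler_wpM2l ?invr_ge0 // big_ord_recl /= mulr0n.
apply: (@le_trans _ _ (\sum_(k < n.+1) w (h n *+ k.+1) (T (h n) y))).
  rewrite big_ord_recr /= addrC; apply: lerD; first by rewrite hE w_wrap.
  exact: ler_sum.
apply: ler_sum => k _; rewrite mulrSr; have /andP[a0 _] := grid (ltnW (ltn_ord k)).
by apply: w_step; rewrite ?(ltW (h_gt0 n)) // -mulrSr; case/andP: (grid (ltn_ord k)).
Qed.

Lemma average_iter n m y : average n (T (h n *+ m) y) <= average n y.
Proof.
have [_ T0 TD _] := hT; elim: m => [|m IH]; first by rewrite mulr0n T0.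
rewrite mulrS TD ?mulrn_wge0 ?(ltW (h_gt0 n)) //.
exact: le_trans (average_step _ _) IH.
Qed.

Lemma average_le C n y : (forall t x, 0 <= t <= tau -> w t x <= C * nsq x) ->
  average n y <= C * nsq y.
Proof.
move=> wC; rewrite ler_pdivrMl ?ltr0n //.
have -> : n.+1%:R * (C * nsq y) = \sum_(k < n.+1) C * nsq y.
  by rewrite sumr_const card_ord mulr_natl.
by apply: ler_sum => k _; apply/wC/grid/ltnW.
Qed.

Lemma average_ge c n y : (forall t x, 0 <= t <= tau -> c * nsq x <= w t x) ->
  c * nsq y <= average n y.
Proof.
move=> wc; rewrite ler_pdivlMl ?ltr0n //.
have -> : n.+1%:R * (c * nsq y) = \sum_(k < n.+1) c * nsq y.
  by rewrite sumr_const card_ord mulr_natl.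
by apply: ler_sum => k _; apply/wc/grid/ltnW.
Qed.

(** [t] is rounded down to a multiple [s] of the grid step: [average_iter] handles [T s x], and
    strong continuity at [t] makes the remainder small on fine grids. *)
Lemma average_eventually_le C t x e : 0 <= t -> 0 < e ->
  (forall t x, 0 <= t <= tau -> w t x <= C * nsq x) ->
  exists N, forall n, (N <= n)%N -> average n (T t x) <= (1 + e) * average n x + e.
Proof.
move=> t0 e0 wC; have [_ _ _ Tcont] := hT.
(* Makes the remainder term of [quadD_eps] at most [D * (e / D) = e]; [|C| + 1] is positive whatever
   the sign of [C]. *)
pose D := (1 + e^-1) * (`|C| + 1).
have D0 : 0 < D by apply: mulr_gt0; [rewrite addr_gt0 ?invr_gt0|rewrite ltr_wpDl].
pose d := Num.sqrt (e / D).
have d2 : d ^+ 2 = e / D by rewrite sqr_sqrtr // divr_ge0 // ltW.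
have d0 : 0 < d by rewrite sqrtr_gt0 divr_gt0.
have [d' d'0 hd'] := Tcont x t t0 d d0.
exists (Num.truncn (tau / d')) => n Nn.
have hn : h n < d'.
  rewrite /h ltr_pdivrMr ?ltr0n // mulrC -ltr_pdivrMr //.
  by rewrite (lt_le_trans (truncnS_gt _)) // ler_nat ltnS.
pose m := Num.truncn (t / h n).
have /andP[mt tm] : m%:R <= t / h n < m.+1%:R by apply: truncn_itv; rewrite divr_ge0 // ltW.
pose s := h n *+ m.
have s0 : 0 <= s by rewrite mulrn_wge0 ?(ltW (h_gt0 n)).
have st : s <= t by rewrite /s -mulr_natl -ler_pdivlMr.
have ts : t < s + h n by rewrite /s -mulrSr -mulr_natl -ltr_pdivrMr.
have small : nsq (T t x - T s x) < e / D.
  rewrite -d2 -(hnorm_sqr hH) ltr_pXn2r ?nnegrE ?hnorm_ge0 ?(ltW d0) //.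
  by rewrite (hnorm_distC hH); apply: hd' => //; rewrite distrC ger0_norm ?subr_ge0 //; lra.
have -> : T t x = T s x + (T t x - T s x) by rewrite addrC subrK.
apply: le_trans (quadD_eps (average_quad n) _ _ e0) _; apply: lerD.
  by rewrite ler_wpM2l ?addr_ge0 ?(ltW e0) // average_iter.
have : average n (T t x - T s x) <= (`|C| + 1) * nsq (T t x - T s x).
  apply: average_le => r z r01; rewrite (le_trans (wC _ _ r01)) // ler_wpM2r ?(nsq_ge0 hH) //.
  by rewrite (le_trans (ler_norm C)) // lerDl.
have f0 : 0 <= 1 + e^-1 by rewrite addr_ge0 // invr_ge0 ltW.
move=> /(ler_wpM2l f0) /le_trans; apply; rewrite mulrA -/D -ler_pdivlMl // mulrC.
exact: ltW.
Qed.

Lemma contractive_limit c C :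
  (forall t x, 0 <= t <= tau -> c * nsq x <= w t x <= C * nsq x) ->
  exists N : H -> R, [/\ quad N, forall x, c * nsq x <= N x <= C * nsq x &
    forall t x, 0 <= t -> N (T t x) <= N x].
Proof.
move=> wcC; have wc t x : 0 <= t <= tau -> c * nsq x <= w t x by move=> /(wcC t x)/andP[].
have wC t x : 0 <= t <= tau -> w t x <= C * nsq x by move=> /(wcC t x)/andP[].
have [L [LD LZ Lc Lle]] := generalized_limit R.
have bdd x : bounded_seq (average^~ x).
  exists (C * nsq x) => n; rewrite ger0_norm; first exact: average_le.
  by case: (average_quad n).
have bddc (a : R) : bounded_seq (fun=> a) by exists `|a|.
have bddZ (a : R) u : bounded_seq u -> bounded_seq (fun n => a * u n).
  by move=> [K hK]; exists (`|a| * K) => n; rewrite normrM ler_wpM2l.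
have bddD (u v : nat -> R) : bounded_seq u -> bounded_seq v -> bounded_seq (fun n => u n + v n).
  by move=> [K hK] [K' hK']; exists (K + K') => n; rewrite (le_trans (ler_normD _ _)) // lerD.
pose N x := L (average^~ x); exists N; split.
- split=> [x|x y|a x].
  + rewrite -(Lc 0); apply: (Lle 0%N) => // n _; by case: (average_quad n).
  (* [L] is linear on bounded sequences, so identities valid for every average pass to [N]. *)
  + rewrite /N -!LZ // -!LD //; last 2 first; try exact: bddZ.
    by congr L; apply: funext => n; case: (average_quad n).
  + by rewrite /N -LZ //; congr L; apply: funext => n; case: (average_quad n).
- move=> x; apply/andP; split.
    by rewrite -[leLHS]Lc; apply: (Lle 0%N) => // n _; exact: average_ge.
  by rewrite -[leRHS]Lc; apply: (Lle 0%N) => // n _; exact: average_le.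
move=> t x t0.
have le_eps e : 0 < e -> N (T t x) <= (1 + e) * N x + e.
  move=> e0; have [n0 hn0] := average_eventually_le x t0 e0 wC.
  rewrite -LZ // -[X in _ <= _ + X]Lc -LD //; last exact: bddZ.
  by apply: (Lle n0) => //; apply: bddD => //; exact: bddZ.
have N0 : 0 <= N x by rewrite -(Lc 0); apply: (Lle 0%N) => // n _; case: (average_quad n).
apply/ler_addgt0Pr => e e0.
have N1 : 0 < N x + 1 by rewrite ltr_wpDl.
(* With this tolerance the total excess over [N x] is exactly [e]. *)
have := le_eps (e / (N x + 1)); rewrite divr_gt0 // => /(_ isT).
have -> : (1 + e / (N x + 1)) * N x + e / (N x + 1) = N x + e by field; rewrite gt_eqF.
by [].
Qed.
End Average.

Lemma similarity_quad S Si : invertible_with ip S Si ->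
  quad (fun x => nsq (S x)) /\
  exists2 k : R, 0 < k & forall x, nsq (S x) <= k * nsq x /\ nsq x <= k * nsq (S x).
Proof.
move=> [[Slin [M hM]] [_ [M' hM']] SK SiK]; split.
  exact: quad_comp (nsq_quad hH) Slin.
(* One constant serves both directions; the [+ 1] keeps it positive. *)
have k1 : 0 < M ^+ 2 + M' ^+ 2 + 1 by rewrite ltr_wpDl // addr_ge0 ?sqr_ge0.
exists (M ^+ 2 + M' ^+ 2 + 1) => // x; split.
  rewrite (le_trans (nsq_le_hnorm hH (hM x))) // ler_wpM2r ?(nsq_ge0 hH) //.
  by have := sqr_ge0 M'; lra.
have := nsq_le_hnorm hH (hM' (S x)); rewrite SK => /le_trans; apply.
by rewrite ler_wpM2r ?(nsq_ge0 hH) //; have := sqr_ge0 M; lra.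
Qed.

Lemma opnorm_le_nsq (A S Si : H -> H) (c : R) (x : H) : cancel S Si ->
  opnorm_le ip (fun x => S (A (Si x))) c -> nsq (S (A x)) <= c ^+ 2 * nsq (S x).
Proof. by move=> SK h; have := nsq_le_hnorm hH (h (S x)); rewrite SK. Qed.

End ContractiveRenorming.

Theorem theorem1p4 (R : realType) (H : lmodType R[i]) (ip : H -> H -> R[i])
  (hH : hilbert_space ip) (T : R -> H -> H) (hT : C0_semigroup ip T) :
  similar_to_contraction_sg ip T <->
  (similar_to_quasi_contraction_sg ip T /\
   exists2 tau : R, 0 < tau & similar_to_contraction ip (T tau)).
Proof.
split=> [[S [Si [Sinv hS]]]|].
  split; last by exists 1 => //; exists S, Si; split=> //; exact: hS.
  exists S, Si, 0; split=> // t t0; rewrite mul0r expR0; exact: hS.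
move=> [[S2 [S2i [lam [inv2 h2]]]] [tau tau0 [S1 [S1i [inv1 h1]]]]].
have [quad1 [k1 k10 e1]] := similarity_quad hH inv1.
have [quad2 [k2 k20 e2]] := similarity_quad hH inv2.
have [[_ _ S1K _] [_ _ S2K _]] := (inv1, inv2).
(* A common equivalence constant for the two norms. *)
pose k := k1 + k2; have k0 : 0 < k by rewrite addr_gt0.
have widen1 a x : a <= k1 * nsq ip x -> a <= k * nsq ip x.
  by move=> /le_trans; apply; rewrite ler_wpM2r ?(nsq_ge0 hH) // lerDl ltW.
have widen2 a x : a <= k2 * nsq ip x -> a <= k * nsq ip x.
  by move=> /le_trans; apply; rewrite ler_wpM2r ?(nsq_ge0 hH) // lerDr ltW.
have q1_le x := widen1 _ _ (proj1 (e1 x)); have q1_ge x := widen1 _ _ (proj2 (e1 x)).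
have q2_le x := widen2 _ _ (proj1 (e2 x)); have q2_ge x := widen2 _ _ (proj2 (e2 x)).
have q1_tau x : nsq ip (S1 (T tau x)) <= nsq ip (S1 x).
  by have := opnorm_le_nsq hH x S1K h1; rewrite expr1n mul1r.
(* The exponent doubles because norms are squared, and [|lam|] ensures a nonnegative growth rate. *)
have q2_sg (t : R) x : 0 <= t ->
    nsq ip (S2 (T t x)) <= expR (2 * `|lam| * t) * nsq ip (S2 x).
  move=> t0; rewrite (le_trans (opnorm_le_nsq hH x S2K (h2 t t0))) //.
  rewrite ler_wpM2r ?(nsq_ge0 hH) // -expRM_natl ler_expR mulrA ler_wpM2r //.
  by rewrite ler_wpM2l // ler_norm.
have lam0 : 0 <= `|lam| by [].
have [c c0 wc] := moving_quad_ge hT quad1 quad2 k0 lam0 q1_le q1_ge q2_le q2_ge q1_tau q2_sg.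
have wC := moving_quad_le hT quad2 tau0 k0 lam0 q1_le q2_le q2_ge q1_tau q2_sg.
have wP := moving_quadP hT `|lam| quad1 quad2 tau0 q1_tau.
have wS := moving_quad_step hT quad2 q1_tau q2_sg.
have w0 := moving_quad0 hT `|lam| quad2 q1_tau.
have wtau := moving_quad_tau hT `|lam| quad2 q1_tau.
have w_wrap y := le_trans (w0 y) (wtau y).
have w_bounds t x h := introT andP (conj (wc t x h) (wC t x h)).
have [N [N_quad N_bounds N_sg]] := contractive_limit hH hT tau0 wP wS w_wrap w_bounds.
have [S [Si [Sinv SN]]] := quad_renorm hH N_quad c0 N_bounds.
exists S, Si; split=> // t t0 x; have [_ _ _ SiK] := Sinv.
by apply: (hnorm_le_nsq hH) => //; rewrite expr1n mul1r SN -[in leRHS](SiK x) SN N_sg.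
Qed.
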